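(* Let $N\geqslant 1$. There is a dense $G_\delta$ subset $\mathcal B$ of the space $\operatorname{Emb}(\mathcal C,\mathbb R^N)$ such that for each $f\in\mathcal B$ and each linear subspace $L\subset\mathbb R^N$ with $L\neq\{0\}$, the orthogonal projection of $f(\mathcal C)$ into $L$ is a Cantor set.
   Context: $\mathcal C\subset[0,1]$ denotes the standard middle-thirds Cantor set; a Cantor set is any topological space homeomorphic to $\mathcal C$. $\operatorname{Emb}(\mathcal C,\mathbb R^N)$ is the space of all topological embeddings of $\mathcal C$ into $\mathbb R^N$, with the metric $\rho(f,g)=\sup\{d(f(x),g(x))\mid x\in\mathcal C\}$, where $d$ is the Euclidean distance. *)

(* Defs.v *)
From HB Require Import structures.
From mathcomp Require Import all_boot all_order all_algebra.
From mathcomp Require Import ring lra.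
From mathcomp Require Import all_classical all_reals all_analysis borel_hierarchy.

Set Implicit Arguments.
Unset Strict Implicit.
Unset Printing Implicit Defensive.

Import Order.TTheory GRing.Theory Num.Theory.
Import numFieldNormedType.Exports.

Local Open Scope classical_set_scope.
Local Open Scope ring_scope.

Definition homeomorphism (S T : topologicalType) (h : S -> T) : Prop :=
  exists g : T -> S,
    [/\ cancel h g, cancel g h, continuous h & continuous g].

Definition homeomorphic (S T : topologicalType) : Prop :=
  exists h : S -> T, homeomorphism h.

Definition corestrict (S T : Type) (f : S -> T) (x : S) : range f :=
  exist _ (f x) (mem_set (imageT f x)).

(* homeomorphism onto the image, the latter with the topology induced by T *)
Definition embedding (S T : topologicalType) (f : S -> T) : Prop :=
  homeomorphism (corestrict f).

(* n-th stage of the middle-thirds construction *)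
Fixpoint cantor_stage (R : realType) (n : nat) : set R :=
  if n is m.+1 then
    [set x / 3 | x in cantor_stage m] `|`
    [set (2 + x) / 3 | x in cantor_stage m]
  else `[0, 1].

Arguments cantor_stage : clear implicits.

Definition cantor_set (R : realType) : set R := \bigcap_n cantor_stage R n.

Arguments cantor_set : clear implicits.

Definition is_cantor_space (R : realType) (T : topologicalType) : Prop :=
  homeomorphic (cantor_set R) T.

Section Euclidean.
Context {R : realType} {N : nat}.
Implicit Types u v w : 'rV[R]_N.

Definition dotv u v : R := \sum_(i < N) u 0 i * v 0 i.

Lemma dotvC u v : dotv u v = dotv v u.
Proof. by apply: eq_bigr => i _; rewrite mulrC. Qed.

Lemma dotv_is_bilinear :
  bilinear_for (GRing.Scale.Law.clone _ _ *%R _)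
    (GRing.Scale.Law.clone _ _ (idfun \; *%R) _) dotv.
Proof.
have dotvP w a u v : dotv (a *: u + v) w = a * dotv u w + dotv v w.
  rewrite /dotv mulr_sumr -big_split; apply: eq_bigr => i _ /=.
  by rewrite !mxE mulrDl mulrA.
split=> [w a u v|w a u v] /=; first exact: dotvP.
by rewrite dotvC dotvP !(dotvC w).
Qed.

HB.instance Definition _ := bilinear_isBilinear.Build R 'rV[R]_N 'rV[R]_N R
  (GRing.Scale.Law.clone _ _ *%R _)
  (GRing.Scale.Law.clone _ _ (idfun \; *%R) _) dotv dotv_is_bilinear.

Lemma dotv_is_hermitian u v : dotv u v = (-1) ^+ false * idfun (dotv v u).
Proof. by rewrite /= expr0 mul1r dotvC. Qed.

HB.instance Definition _ :=
  isHermitianSesquilinear.Build R 'rV[R]_N false idfun dotv dotv_is_hermitian.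

Lemma dotv_gt0 u : u != 0 -> 0 < dotv u u.
Proof.
move=> u0; rewrite lt_neqAle; apply/andP; split; last first.
  by apply: sumr_ge0 => i _; exact: sqr_ge0.
apply: contra u0; rewrite eq_sym psumr_eq0; last by move=> i _; exact: sqr_ge0.
move=> /allP u0; apply/eqP/rowP => i; rewrite mxE.
by have := u0 i (mem_index_enum i); rewrite mulf_eq0 orbb => /eqP.
Qed.

HB.instance Definition _ := isDotProduct.Build R 'rV[R]_N dotv dotv_gt0.

Lemma dotv_ge0 u : 0 <= dotv u u.
Proof. by apply: sumr_ge0 => i _; exact: sqr_ge0. Qed.

Definition enorm u : R := Num.sqrt (dotv u u).

(* The library topology on 'rV[R]_N comes from the sup norm; it is the usual
   topology of R^N, i.e. the one induced by edist. *)
Definition edist u v : R := enorm (u - v).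

Lemma enorm_ge0 u : 0 <= enorm u. Proof. exact: sqrtr_ge0. Qed.

Lemma sqr_enorm u : enorm u ^+ 2 = dotv u u.
Proof. by rewrite sqr_sqrtr// dotv_ge0. Qed.

Lemma enorm0 : enorm 0 = 0.
Proof. by rewrite /enorm linear0l sqrtr0. Qed.

Lemma enorm_eq0 u : enorm u = 0 -> u = 0.
Proof.
move=> u0; apply/eqP/negPn/negP => /dotv_gt0.
by rewrite -sqr_enorm u0 expr0n ltxx.
Qed.

Lemma enormN u : enorm (- u) = enorm u.
Proof. by rewrite /enorm linearNl linearNr opprK. Qed.

Lemma dotv_le_enorm u v : dotv u v <= enorm u * enorm v.
Proof.
have [->|v0] := eqVneq v 0; first by rewrite linear0r enorm0 mulr0.
have v_gt0 := dotv_gt0 v0.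
have := dotv_ge0 (dotv v v *: u - dotv u v *: v).
rewrite linearBl/= !linearBr/= !linearZl_LR/= !linearZr_LR/= (dotvC v u).
set a := dotv v v; set b := dotv u v; set c := dotv u u => h.
apply: (le_trans (ler_norm _)).
rewrite -(ler_pXn2r (ltn0Sn 1)) ?nnegrE ?normr_ge0 ?mulr_ge0 ?enorm_ge0//.
rewrite exprMn !sqr_enorm real_normK ?num_real// -/a -/b -/c.
rewrite -(ler_pM2l v_gt0) -/a -subr_ge0.
by move: h; congr (0 <= _); rewrite /= -![_ *: _]/(_ * _); ring.
Qed.

Lemma ler_enormD u v : enorm (u + v) <= enorm u + enorm v.
Proof.
rewrite -(ler_pXn2r (ltn0Sn 1)) ?nnegrE ?addr_ge0 ?enorm_ge0//.
rewrite sqrrD !sqr_enorm linearDl/= !linearDr/= (dotvC v u).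
have := dotv_le_enorm u v.
by rewrite mulr2n; lra.
Qed.

(* projection onto L along the orthogonal complement of L; see oprojP *)
Definition oproj (L : {vspace 'rV[R]_N}) : 'rV[R]_N -> 'rV[R]_N :=
  daddv_pi L (orthov dotv L).

End Euclidean.

Section OrthogonalProjection.
Context {R : realType} {N : nat}.
Implicit Types (L : {vspace 'rV[R]_N}) (v p : 'rV[R]_N).

Lemma capv_orthov L : (L :&: orthov dotv L = 0)%VS.
Proof.
apply/eqP; rewrite -subv0; apply/subvP => v; rewrite memv_cap memv0.
move=> /andP[vL /mem_orthovP/(_ v vL) vv0]; apply/negPn/negP => /dotv_gt0.
by rewrite vv0 ltxx.
Qed.

Lemma addv_orthov L : (L + orthov dotv L = fullv)%VS.
Proof.
apply/eqP; rewrite eqEdim subvf /= dimv_disjoint_sum ?capv_orthov//.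
pose phi v : 'rV[R]_(\dim L) := \row_i dotv v (vbasis L)`_i.
have phi_lin : linear phi.
  by move=> a u v; apply/rowP => i; rewrite !mxE linearPl.
pose phiL := GRing.isLinear.Build _ _ _ _ phi phi_lin.
pose Phi : {linear 'rV[R]_N -> 'rV[R]_(\dim L)} := HB.pack phi phiL.
rewrite -(limg_ker_dim (linfun Phi) fullv) addnC leq_add//; last first.
  apply: dimvS; apply/subvP => v; rewrite memv_cap memv_ker lfunE /=.
  move=> /andP[_ /eqP/rowP v0]; apply/mem_orthovP => u uL.
  rewrite (coord_vbasis uL) linear_sumr big1// => i _.
  by rewrite linearZr_LR/=; have := v0 i; rewrite !mxE => ->; rewrite mulr0.
by apply: leq_trans (dimvS (subvf _)) _; rewrite dimvf /dim /= mul1n.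
Qed.

Lemma oprojP L v p :
  p = oproj L v <-> p \in L /\ forall u, u \in L -> dotv (v - p) u = 0.
Proof.
have h := daddv_pi_add (capv_orthov L).
have pP : oproj L v \in L /\ forall u, u \in L -> dotv (v - oproj L v) u = 0.
  split; first exact: memv_pi.
  apply/mem_orthovP; have := h v; rewrite addv_orthov memvf => /(_ isT) e.
  by rewrite -{1}e addrC addKr memv_pi.
split=> [->//|[pL pO]]; case: pP => qL qO.
apply/eqP; rewrite -subr_eq0 -memv0 -(capv_orthov L) memv_cap rpredB//=.
apply/mem_orthovP => u uL.
have -> : p - oproj L v = (v - oproj L v) - (v - p).
  by rewrite opprB [RHS]addrC subrKA.
by rewrite linearBl/= qO// pO// subrr.
Qed.

End OrthogonalProjection.

Section CantorSet.
Context {R : realType}.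

Lemma compact_cantor_stage n : compact (cantor_stage R n).
Proof.
elim: n => [|n IH] /=; first exact: segment_compact.
apply: compactU; apply: continuous_compact => //;
  apply: continuous_subspaceT => x.
  by apply: cvgM; [exact: cvg_id|exact: cvg_cst].
by apply: cvgM; [apply: cvgD; [exact: cvg_cst|exact: cvg_id]|exact: cvg_cst].
Qed.

Lemma compact_cantor_set : compact (cantor_set R).
Proof.
apply: (@subclosed_compact _ _ (cantor_stage R 0%N)); last 2 first.
- exact: compact_cantor_stage.
- by move=> x /(_ 0%N); exact.
apply: closed_bigI => n _; apply: (@compact_closed R).
  exact: Rhausdorff.
exact: compact_cantor_stage.
Qed.

Lemma cantor_set0 : cantor_set R 0.
Proof.
move=> n _; elim: n => [|n IH] /=; first by rewrite in_itv/= lexx ler01.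
by left; exists 0 => //; rewrite mul0r.
Qed.

End CantorSet.

Record Emb (R : realType) (N : nat) := MkEmb {
  emb_fun :> cantor_set R -> 'rV[R]_N ;
  emb_embedding : embedding emb_fun }.

HB.instance Definition _ (R : realType) (N : nat) := gen_eqMixin (Emb R N).
HB.instance Definition _ (R : realType) (N : nat) := gen_choiceMixin (Emb R N).

Section EmbMetric.
Context {R : realType} {N : nat}.
Implicit Types f g h : Emb R N.

(* the supremum is finite: see has_sup_rho *)
Definition rho f g : R := sup (range (fun x => edist (f x) (g x))).

Lemma continuous_emb f : continuous f.
Proof.
case: f => f [g [_ _ cf _]] /=.
have -> : f = set_val \o corestrict f by [].
by move=> x; apply: continuous_comp; [exact: cf|exact: initial_continuous].
Qed.

Lemma continuous_edist_emb f g : continuous (fun x => edist (f x) (g x)).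
Proof.
move=> x; apply: (@continuous_comp _ _ _ (fun x => dotv (f x - g x) (f x - g x))
  Num.sqrt); last exact: sqrt_continuous.
have cemb h i : {for x, continuous (fun x => h x 0 i)}.
  apply: (@continuous_comp _ _ _ h (fun v => v 0 i)); first exact: continuous_emb.
  exact: coord_continuous.
have cfg i : {for x, continuous (fun x => (f x - g x) 0 i)}.
  have -> : (fun x => (f x - g x) 0 i) = (fun x => f x 0 i - g x 0 i).
    by apply/funext => y; rewrite !mxE.
  by apply: continuousB; exact: cemb.
rewrite /dotv; elim: (index_enum _) => [|i s IH].
  have -> : (fun y => \sum_(j <- [::]) (f y - g y) 0 j * (f y - g y) 0 j) =
    cst 0 by apply/funext => y; rewrite big_nil.
  exact: cst_continuous.
have -> : (fun y => \sum_(j <- i :: s) (f y - g y) 0 j * (f y - g y) 0 j) =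
    (fun y => (f y - g y) 0 i * (f y - g y) 0 i +
      \sum_(j <- s) (f y - g y) 0 j * (f y - g y) 0 j).
  by apply/funext => y; rewrite big_cons.
by apply: continuousD => //; apply: continuousM; exact: cfg.
Qed.

Lemma has_sup_rho f g : has_sup (range (fun x => edist (f x) (g x))).
Proof.
apply: compact_has_sup.
  by exists (edist (f (exist _ 0 (mem_set cantor_set0)))
                   (g (exist _ 0 (mem_set cantor_set0)))); exact: imageT.
pose d : cantor_set R -> R := fun x => edist (f x) (g x).
rewrite -/d.
have dE (y : cantor_set R) : valL_ 0 d (set_val y) = d y.
  by have /(congr1 (fun k => k y)) := @valLK _ _ 0 (cantor_set R) d.
have -> : range d = valL_ 0 d @` cantor_set R.
  apply/seteqP; split => [_ [x _ <-]|_ [x Cx <-]].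
    by exists (set_val x); [exact: set_valP|exact: dE].
  by exists (exist _ x (mem_set Cx)) => //; rewrite -dE.
apply: continuous_compact compact_cantor_set.
by apply/subspace_valL_continuousP'; exact: continuous_edist_emb.
Qed.

Lemma edist_le_rho f g x : edist (f x) (g x) <= rho f g.
Proof. by apply: ub_le_sup; [case: (has_sup_rho f g)|exact: imageT]. Qed.

Lemma rho_le f g r : (forall x, edist (f x) (g x) <= r) -> rho f g <= r.
Proof.
move=> fgr; apply: ge_sup; first by case: (has_sup_rho f g).
by move=> _ [x _ <-].
Qed.

Lemma rhoxx f : rho f f = 0.
Proof.
have e0 x : edist (f x) (f x) = 0 by rewrite /edist subrr enorm0.
apply/eqP; rewrite eq_le; apply/andP; split.
  by apply: rho_le => x; rewrite e0.
by rewrite -(e0 (exist _ 0 (mem_set cantor_set0))) edist_le_rho.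
Qed.

Lemma rho_positivity f g : rho f g = 0 -> f = g.
Proof.
move=> fg0; have fg : emb_fun f = emb_fun g.
  apply/funext => x; apply/subr0_eq/enorm_eq0/eqP.
  by rewrite eq_le enorm_ge0 andbT -fg0 edist_le_rho.
case: f g fg {fg0} => f ef [g eg] /= fg; subst g.
by congr MkEmb; exact: Prop_irrelevance.
Qed.

Lemma rho_sym f g : rho f g = rho g f.
Proof.
rewrite /rho; have -> // : (fun x => edist (f x) (g x)) =
  (fun x => edist (g x) (f x)).
by apply/funext => x; rewrite {1}/edist -enormN opprB.
Qed.

Lemma rho_triangle g f h : rho f h <= rho f g + rho g h.
Proof.
apply: rho_le => x.
apply: le_trans (lerD (edist_le_rho f g x) (edist_le_rho g h x)).
by rewrite /edist -(subrKA (g x)) ler_enormD.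
Qed.

HB.instance Definition _ := isMetric.Build R (Emb R N)
  rhoxx rho_positivity rho_sym rho_triangle.

End EmbMetric.

(* Main.v *)
Require Import Defs.
From mathcomp Require Import all_boot all_order all_algebra.
From mathcomp Require Import all_classical all_reals all_analysis borel_hierarchy.
From HB Require Import structures.
From mathcomp Require Import ring lra.

(** Call [f] thin if, for every [e > 0], [C] splits into [2 ^ k] pieces whose
    images have diameters adding up to less than [e], and spread if, for every
    piece of [C], no nonzero linear form is constant on the image of that piece.
    If [f] is thin, no linear form [u] maps [f(C)] onto a set containing an
    interval, so the clopen sets [u < s] separate the points of each projection;
    if [f] is spread, the projections have no isolated point. Being compact and
    metrizable, they are then Cantor sets. In quantitative form both conditions
    are countable intersections of open ones. For density, round [f] to a
    locally constant map and add a small multiple of the moment curve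
    [x |-> (x, x^2, ..., x^N)]: it is Lipschitz and [C] is covered by [2 ^ k]
    sets of diameter [3 ^ -k], so the result is thin, and it is spread because a
    nonzero polynomial of degree at most [N] without constant term is not
    constant on [N + 1] distinct points. Thus Baire's theorem is not needed. *)

Set Implicit Arguments.
Unset Strict Implicit.
Unset Printing Implicit Defensive.
Import Order.TTheory GRing.Theory Num.Theory.
Import numFieldNormedType.Exports.

Local Open Scope classical_set_scope.
Local Open Scope ring_scope.

Local Notation edist := Defs.edist.

(** * Compact spaces and Brouwer's characterization of the Cantor set *)

Lemma compact_set_type (T : topologicalType) (K : set T) :
  compact K -> compact [set: K].
Proof.
move=> cK.
have [[k0]|K0] := pselect (inhabited K); last first.
  have -> : [set: K] = set0.
    by apply/seteqP; split=> // x _; exfalso; apply: K0.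
  exact: compact0.
(* Off [K] the map [h] takes the default value [k0]; only its continuity on the subspace [K]
   matters. *)
pose h : T -> K := valL_ k0 (@idfun K).
have <- : h @` K = [set: K].
  apply/seteqP; split=> // x _; exists (set_val x); first exact: set_valP.
  by have /(congr1 (fun k => k x)) := @valLK _ _ k0 K (@idfun K).
apply: continuous_compact cK.
by apply/subspace_valL_continuousP' => x; exact: cvg_id.
Qed.

Lemma hausdorff_set_type (T : topologicalType) (K : set T) :
  hausdorff_space T -> hausdorff_space K.
Proof.
move=> hT x y xy; apply: val_inj; apply: hT => A B Ax By.
have [z [Az Bz]] := xy _ _ (@initial_continuous K T set_val x _ Ax)
  (@initial_continuous K T set_val y _ By).
by exists (set_val z).
Qed.

(** Closed sets of [S] are compact, so their images are compact, hence closed: this is the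
    continuity of the inverse. *)
Lemma homeomorphism_compact (S T : topologicalType) (h : S -> T) :
  compact [set: S] -> hausdorff_space T -> continuous h -> bijective h ->
  homeomorphism h.
Proof.
move=> cS hT ch [g hK gK]; exists g; split=> //.
apply/continuous_closedP => A cA; have -> : g @^-1` A = h @` A.
  apply/seteqP; split=> [y Ay|_ [x Ax <-]]; first by exists (g y).
  by rewrite /preimage /= hK.
apply: (compact_closed hT); apply: continuous_compact.
  exact: continuous_subspaceT.
exact: subclosed_compact cA cS _.
Qed.

Lemma homeomorphic_sym (S T : topologicalType) :
  homeomorphic S T -> homeomorphic T S.
Proof. by move=> [h [g [hK gK ch cg]]]; exists g, h. Qed.

Lemma homeomorphic_trans (S T U : topologicalType) :
  homeomorphic S T -> homeomorphic T U -> homeomorphic S U.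
Proof.
move=> [h [g [hK gK ch cg]]] [h' [g' [hK' gK' ch' cg']]].
exists (h' \o h), (g \o g'); split; try exact: can_comp.
- by move=> x; apply: continuous_comp; [exact: ch|exact: ch'].
- by move=> x; apply: continuous_comp; [exact: cg'|exact: cg].
Qed.

(** Brouwer's theorem, with [t] as the base point that [homeomorphism_cantor_like] asks for. *)
Lemma homeomorphic_cantor_space (R : realType) (T : pseudoMetricType R)
    (t : T) :
  cantor_like T -> homeomorphic cantor_space T.
Proof.
move=> cT; pose pT := isPointed.Build T t.
pose P : pseudoPMetricType R := HB.pack (T : Type) T pT.
have [f [cf _]] := @homeomorphism_cantor_like R P cT.
exists f; apply: homeomorphism_compact => //.
- exact: cantor_space_compact.
- by case: cT.
Qed.

Lemma homeomorphic_cantor_like (R : realType) (S T : pseudoMetricType R)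
  (s : S) (t : T) : cantor_like S -> cantor_like T -> homeomorphic S T.
Proof.
move=> cS cT; apply: homeomorphic_trans (homeomorphic_cantor_space t cT).
exact/homeomorphic_sym/(homeomorphic_cantor_space s cS).
Qed.

Lemma injective_embedding (S T : topologicalType) (f : S -> T) :
  compact [set: S] -> hausdorff_space T -> continuous f -> injective f ->
  embedding f.
Proof.
move=> cS hT cf f_inj; apply: homeomorphism_compact => //.
- exact: hausdorff_set_type.
- by apply: continuous_comp_initial => x; exact: cf.
- rewrite -setTT_bijective; split=> //.
    by move=> x y _ _ /(congr1 val)/f_inj.
  move=> [y /= yf] _; have /set_mem[x _ xy] := yf.
  by exists x => //; apply: val_inj.
Qed.

(** * Ternary expansions of the points of the middle-thirds set *)

Section Itinerary.
Context {R : realType}.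
Implicit Types (x y : R) (b : bool) (w : seq bool) (n : nat).

Definition branch b x : R := if b then (2 + x) / 3 else x / 3.

(** The head of [w] is applied last, so it selects the coarsest third. *)
Definition branches w x : R := foldr branch x w.

(** The cut [2^-1] lies in the removed middle third, so on the Cantor set it tells the two branches
    apart; the recursion goes on at the preimage under the branch found. *)
Fixpoint itinerary n x : seq bool :=
  if n is m.+1 then
    (2^-1 < x) :: itinerary m (if 2^-1 < x then 3 * x - 2 else 3 * x)
  else [::].

Lemma size_itinerary n x : size (itinerary n x) == n.
Proof. by elim: n x => //= n IH x; rewrite eqSS. Qed.

Lemma cantor_stage_itv n x : cantor_stage R n x -> 0 <= x <= 1.
Proof.
elim: n x => [|n IH] x /=; first by rewrite in_itv.
by case=> -[y /IH/andP[y0 y1] <-]; apply/andP; split; lra.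
Qed.

Lemma cantor_set_itv x : cantor_set R x -> 0 <= x <= 1.
Proof. by move=> /(_ 0%N I) /cantor_stage_itv. Qed.

Lemma cantor_set_branch b x : cantor_set R x -> cantor_set R (branch b x).
Proof.
move=> Cx [_ /=|n _]; last first.
  by rewrite /branch; case: b; [right|left]; exists x => //; exact: Cx.
have /andP[x0 x1] := cantor_set_itv Cx.
by rewrite in_itv/= /branch; case: b; apply/andP; split; lra.
Qed.

Lemma cantor_set_branches w x : cantor_set R x -> cantor_set R (branches w x).
Proof. by move=> Cx; elim: w => //= b w; exact: cantor_set_branch. Qed.

Lemma cantor_set1 : cantor_set R 1.
Proof.
move=> n _; elim: n => [|n IH] /=; first by rewrite in_itv/= lexx ler01.
by right; exists 1 => //; lra.
Qed.

Lemma gt_half_branch b x : 0 <= x <= 1 -> (2^-1 < branch b x) = b.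
Proof.
move=> /andP[x0 x1]; rewrite /branch; case: b; first by apply/idP; lra.
by apply/negbTE; rewrite -leNgt; lra.
Qed.

Lemma cantor_set_preimage x : cantor_set R x ->
  cantor_set R (if 2^-1 < x then 3 * x - 2 else 3 * x).
Proof.
move=> Cx n _; have /= := Cx n.+1 I.
case=> -[y yn <-]; have y01 := cantor_stage_itv yn.
- have := gt_half_branch false y01; rewrite /branch => ->.
  by rewrite mulrC divfK.
- have := gt_half_branch true y01; rewrite /branch => ->.
  by rewrite mulrC divfK // addrC addKr.
Qed.

Lemma branches_itinerary n x : cantor_set R x ->
  exists2 y, cantor_set R y & x = branches (itinerary n x) y.
Proof.
elim: n x => [|n IH] x Cx /=; first by exists x.
have [y Cy e] := IH _ (cantor_set_preimage Cx); exists y => //.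
by rewrite -e /branch; case: (2^-1 < x); lra.
Qed.

Lemma itinerary_branches w x : cantor_set R x ->
  itinerary (size w) (branches w x) = w.
Proof.
move=> Cx; elim: w => //= b w IH.
rewrite gt_half_branch ?cantor_set_itv//; last exact: cantor_set_branches.
rewrite -[RHS](congr1 (cons b) IH); congr (_ :: itinerary _ _).
by rewrite /branch; case: b => /=; lra.
Qed.

Lemma branchesE w x : branches w x = branches w 0 + 3^-1 ^+ size w * x.
Proof.
elim: w => [|b w IH] /=; first by rewrite add0r expr0 mul1r.
by rewrite IH exprS /branch; case: b; lra.
Qed.

(** Both points are images of points of [[0, 1]] under the same affine contraction of ratio
    [3^-n]. *)
Lemma itinerary_dist n x y : cantor_set R x -> cantor_set R y ->
  itinerary n x = itinerary n y -> `|x - y| <= 3^-1 ^+ n.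
Proof.
move=> Cx Cy exy.
have [x' Cx' ->] := branches_itinerary n Cx.
have [y' Cy' ->] := branches_itinerary n Cy.
rewrite exy (branchesE _ x') (branchesE _ y') (eqP (size_itinerary _ _)).
rewrite opprD addrACA subrr add0r -mulrBr normrM.
rewrite gtr0_norm ?exprn_gt0 // ?invr_gt0//.
rewrite ler_piMr ?exprn_ge0 ?invr_ge0//.
have /andP[? ?] := cantor_set_itv Cx'; have /andP[? ?] := cantor_set_itv Cy'.
by rewrite ler_norml; apply/andP; split; lra.
Qed.

(** Points on different sides of the removed third are at least [1/3] apart, so closer points share
    their first letter; rescaling by 3 gives the induction. Strictness matters: [1/3] and [2/3] have
    different first letters. *)
Lemma dist_itinerary n x y : cantor_set R x -> cantor_set R y ->
  `|x - y| < 3^-1 ^+ n -> itinerary n x = itinerary n y.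
Proof.
elim: n x y => //= n IH x y Cx Cy xy.
have p1 : (3^-1 : R) ^+ n <= 1.
  by rewrite exprn_ile1 // ?invr_ge0 // invf_le1 // ler1n.
have p3 : `|x - y| < 3^-1 by rewrite (lt_le_trans xy) // exprS ler_piMr.
have /andP[px0 px1] := cantor_set_itv (cantor_set_preimage Cx).
have /andP[py0 py1] := cantor_set_itv (cantor_set_preimage Cy).
move: p3; rewrite ltr_norml => /andP[p3 p3'].
have exy : (2^-1 < x) = (2^-1 < y).
  by move: px0 px1 py0 py1; case: (ltP 2^-1 x); case: (ltP 2^-1 y) => // *; lra.
rewrite -exy; congr (_ :: _); apply: IH.
- exact: cantor_set_preimage.
- by have := cantor_set_preimage Cy; rewrite -exy.
- have -> : (if 2^-1 < x then 3 * x - 2 else 3 * x) -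
     (if 2^-1 < x then 3 * y - 2 else 3 * y) = 3 * (x - y).
    by case: ifP => _; lra.
  rewrite normrM (ger0_norm (ler0n _ 3)); move: xy; rewrite exprS.
  by rewrite ltr_pdivlMl // ltr0n.
Qed.

End Itinerary.

(** * The Euclidean norm and linear forms *)

Section EuclideanSpace.
Context {R : realType} {N : nat}.
Implicit Types u v : 'rV[R]_N.

Lemma ler_norm_dotv u v : `|dotv u v| <= enorm u * enorm v.
Proof.
rewrite ler_norml dotv_le_enorm andbT lerNl -(enormN u).
by apply: le_trans (dotv_le_enorm _ _); rewrite linearNl.
Qed.

Lemma enormZ a v : enorm (a *: v) = `|a| * enorm v.
Proof.
apply/eqP; rewrite -(eqrXn2 (ltn0Sn 1)) ?mulr_ge0 ?enorm_ge0//.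
rewrite exprMn !sqr_enorm real_normK ?num_real//; apply/eqP.
rewrite /dotv mulr_sumr; apply: eq_bigr => i _; rewrite !mxE; ring.
Qed.

Lemma enorm_le_sum v : enorm v <= \sum_i `|v 0 i|.
Proof.
have S0 : 0 <= \sum_i `|v 0 i| by exact: sumr_ge0.
rewrite -(ler_pXn2r (ltn0Sn 1)) ?nnegrE ?enorm_ge0// sqr_enorm expr2.
rewrite /dotv mulr_suml; apply: ler_sum => i _.
rewrite (le_trans (ler_norm _))// normrM ler_wpM2l// (bigD1 i)//=.
by rewrite lerDl sumr_ge0.
Qed.

Lemma edistC u v : edist u v = edist v u.
Proof. by rewrite /edist -enormN opprB. Qed.

Lemma edist_triangle w u v : edist u v <= edist u w + edist w v.
Proof. by rewrite /edist -(subrKA w) ler_enormD. Qed.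

Lemma linear_rV_continuous (V : normedModType R) (f : {linear 'rV[R]_N -> V}) :
  continuous f.
Proof.
have -> : f = (fun v => \sum_(i < N) v 0 i *: f (delta_mx 0 i)) :> (_ -> _).
  apply/funext => v; rewrite [in LHS](row_sum_delta v) linear_sum.
  by apply: eq_bigr => i _; rewrite linearZ.
move=> v; apply: (@cvg_big _ _ _ _ _ _ _ _ _ _ _ (nbhs_filter v)) => [|i _].
  exact: add_continuous.
by apply: cvgZr_tmp; exact: coord_continuous.
Qed.

Lemma dotv_continuous u : continuous (dotv u).
Proof.
move=> v; apply: (@cvg_big _ _ _ _ _ _ _ _ _ _ _ (nbhs_filter v)) => [|i _].
  exact: add_continuous.
apply: (@cvgM _ _ _ (nbhs_filter v)); first exact: cvg_cst.
exact: coord_continuous.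
Qed.

Lemma enorm_continuous : continuous (@enorm R N).
Proof.
move=> v; apply: (@continuous_comp _ _ _ (fun v => dotv v v) Num.sqrt).
  apply: (@cvg_big _ _ _ _ _ _ _ _ _ _ _ (nbhs_filter v)) => [|i _].
    exact: add_continuous.
  by apply: (@cvgM _ _ _ (nbhs_filter v)); exact: coord_continuous.
exact: sqrt_continuous.
Qed.

End EuclideanSpace.

(** * Pigeonhole principle, geometric decay and finite minima *)

(* Two of [#|T|.+1] equidistant points of [[p, q]] get the same colour. *)
Lemma interval_pigeonhole (R : realType) (X : Type) (T : finType) (c : X -> T)
    (phi : X -> R) (d p q : R) :
  (forall x y, c x = c y -> `|phi x - phi y| <= d) ->
  (forall s, p <= s <= q -> exists x, phi x = s) ->
  p <= q -> q - p <= #|T|%:R * d.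
Proof.
move=> cd onto pq; have [x0 _] := onto p (introT andP (conj (lexx p) pq)).
have M0 : 0 < #|T|%:R :> R by rewrite ltr0n; apply/card_gt0P; exists (c x0).
pose s (i : 'I_#|T|.+1) := p + i%:R * ((q - p) / #|T|%:R).
have s_pq i : p <= s i <= q.
  have qp0 : 0 <= q - p by rewrite subr_ge0.
  rewrite /s lerDl mulr_ge0 ?divr_ge0//=.
  rewrite -lerBrDl mulrCA ler_piMr// ler_pdivrMr// mul1r ler_nat.
  by rewrite -ltnS ltn_ord.
have [x xs] := choice (fun i => onto _ (s_pq i)).
have /injectivePn[i [j ij cij]] : ~~ injectiveb (c \o x).
  apply/negP => /injectiveP/leq_card; rewrite card_ord.
  by rewrite ltnn.
rewrite -ler_pdivrMl// mulrC; apply: le_trans (cd _ _ cij).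
rewrite !xs /s opprD addrACA subrr add0r -mulrBl normrM.
rewrite (ger0_norm (divr_ge0 _ (ltW M0))) ?subr_ge0//.
rewrite ler_peMl ?divr_ge0 ?subr_ge0 ?(ltW M0)//.
wlog lt_ij : i j ij {cij} / (j < i)%N => [hw|].
  have [ji|ji|/val_inj ji] := ltngtP j i; first exact: hw.
    by rewrite distrC; apply: hw => //; rewrite eq_sym.
  by rewrite ji eqxx in ij.
by rewrite -natrB 1?ltnW// normr_nat ler1n subn_gt0.
Qed.

Lemma exists_expr_lt (R : realType) (a e : R) : 0 <= a < 1 -> 0 < e ->
  exists k, forall n, (k <= n)%N -> a ^+ n < e.
Proof.
move=> /andP[a0 a1] e0.
have /cvgrPdist_lt/(_ e e0)[k _ hk] : a ^+ n @[n --> \oo] --> 0.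
  by apply: cvg_expr; rewrite ger0_norm.
exists k => n kn; have := hk n kn.
by rewrite /= sub0r normrN ger0_norm ?exprn_ge0.
Qed.

Lemma finite_uniform_pos (R : realType) (T : finType) (P : T -> R -> Prop) :
  (forall w d d', d' <= d -> P w d -> P w d') ->
  (forall w, exists2 d, 0 < d & P w d) ->
  exists2 d, 0 < d & forall w, P w d.
Proof.
move=> Pmono /(_ _)/cid2-/all_sig2[d d0 Pd].
(* The default value 1 keeps the minimum positive when [T] is empty. *)
exists (\big[Num.min/1]_w d w); first exact: lt_bigmin.
by move=> w; apply: Pmono (Pd w); exact: bigmin_le.
Qed.

(** * The moment curve *)

Section MomentCurve.
Context {R : realType} {N : nat}.
Implicit Types u : 'rV[R]_N.

Definition moment (x : R) : 'rV[R]_N := \row_k x ^+ k.+1.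

Lemma moment_continuous : continuous moment.
Proof.
have -> : moment = (fun x => \sum_(k < N) x ^+ k.+1 *: delta_mx 0 k).
  apply/funext => x; rewrite [LHS]row_sum_delta.
  by apply: eq_bigr => k _; rewrite mxE.
move=> x; apply: (@cvg_big _ _ _ _ _ _ _ _ _ _ _ (nbhs_filter x)) => [|k _].
  exact: add_continuous.
apply: (@cvgZr_tmp _ _ _ _ (nbhs_filter x)).
exact: exprn_continuous.
Qed.

Lemma moment_inj : (0 < N)%N -> injective moment.
Proof. by move=> N0 x y /rowP/(_ (Ordinal N0)); rewrite !mxE !expr1. Qed.

Lemma edist_moment_le x y : 0 <= x <= 1 -> 0 <= y <= 1 ->
  edist (moment x) (moment y) <= (\sum_(k < N) k.+1%:R) * `|x - y|.
Proof.
move=> x01 y01; apply: le_trans (enorm_le_sum _) _.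
rewrite mulr_suml; apply: ler_sum => k _; rewrite !mxE subrXX normrM mulrC.
rewrite ler_wpM2r//; apply: le_trans (ler_norm_sum _ _ _) _.
rewrite -[X in _ <= X%:R](card_ord k.+1) -sumr_const; apply: ler_sum => i _.
rewrite normrM !normrX mulr_ile1 ?exprn_ge0//; apply: exprn_ile1 => //.
  by move: x01 => /andP[? ?]; rewrite ger0_norm.
by move: y01 => /andP[? ?]; rewrite ger0_norm.
Qed.

(* As Vandermonde matrices are invertible, every coordinate of [u] is a
   combination of the differences bounded below. *)
Lemma moment_spread (a : 'I_N.+1 -> R) : injective a ->
  exists2 d, 0 < d & forall u, exists i,
    d * enorm u <= `|dotv u (moment (a i) - moment (a ord0))|.
Proof.
move=> a_inj; pose V := Vandermonde N.+1 (\row_i a i).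
have VU : V \in unitmx.
  rewrite unitmxE det_Vandermonde unitfE; apply/prodf_neq0 => i _.
  apply/prodf_neq0 => j ij; rewrite !mxE subr_eq0.
  by apply: contraTneq ij => /a_inj ->; rewrite ltnn.
pose W := invmx V.
have VW (j l : 'I_N.+1) : \sum_i a i ^+ j * W i l = (j == l)%:R.
  have := congr1 (fun A : 'M[R]_(N.+1) => A j l) (mulmxV VU).
  by rewrite !mxE => <-; apply: eq_bigr => i _; rewrite !mxE.
pose D u i := dotv u (moment (a i) - moment (a ord0)).
(* Column [lift ord0 k] of [W] extracts the coefficient of the power [k + 1], which is coordinate
   [k] of [moment]. *)
have uE u k : u 0 k = \sum_i W i (lift ord0 k) * D u i.
  transitivity (\sum_i W i (lift ord0 k) * dotv u (moment (a i))).
    have coef j : \sum_i W i (lift ord0 k) * (u 0 j * moment (a i) 0 j) =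
        u 0 j * (j == k)%:R.
      under eq_bigr do rewrite mxE mulrCA [_ * _ ^+ _]mulrC.
      by rewrite -mulr_sumr (VW (lift ord0 j)) (inj_eq lift_inj).
    under [RHS]eq_bigr do rewrite /dotv mulr_sumr.
    rewrite exchange_big (bigD1 k)//= coef eqxx mulr1 big1 ?addr0// => j jk.
    by rewrite coef (negPf jk) mulr0.
  (* The entries of this column sum to 0, since row 0 of [V] consists of ones; hence the terms in
     [moment (a ord0)] cancel. *)
  under [RHS]eq_bigr do rewrite /D linearBr/= mulrBr.
  rewrite sumrB -mulr_suml.
  have := VW ord0 (lift ord0 k); under eq_bigr do rewrite expr0 mul1r.
  by move=> ->; rewrite mul0r subr0.
pose M : R := \sum_k \sum_i `|W i (lift ord0 k)|.
have M0 : 0 <= M by apply: sumr_ge0 => k _; exact: sumr_ge0.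
(* If every difference were below [enorm u / (1 + M)], then [uE] would give
   [enorm u <= M / (1 + M) * enorm u], which is absurd. *)
exists (1 + M)^-1; first by rewrite invr_gt0 ltr_wpDr.
move=> u; apply: contrapT => /forallNP hu.
have {}hu i : `|D u i| < (1 + M)^-1 * enorm u.
  by rewrite ltNge; apply/negP; exact: hu.
have u0 : 0 < enorm u.
  have := le_lt_trans (normr_ge0 _) (hu ord0).
  by rewrite pmulr_rgt0// invr_gt0 ltr_wpDr.
have : enorm u <= M * ((1 + M)^-1 * enorm u).
  apply: le_trans (enorm_le_sum u) _; rewrite mulr_suml; apply: ler_sum => k _.
  rewrite uE mulr_suml; apply: le_trans (ler_norm_sum _ _ _) _.
  by apply: ler_sum => i _; rewrite normrM ler_wpM2l// ltW.
rewrite mulrA ler_pMl//.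
by rewrite leNgt ltr_pdivrMr ?mul1r ?ltrDr ?ltr01// ltr_wpDr.
Qed.
End MomentCurve.

(** * Addresses as clopen partitions of the Cantor set *)

Section GenericEmbeddings.
Context {R : realType} {N : nat}.
Local Notation C := (cantor_set R).
Implicit Types (x y : C) (f g : Emb R N).

Definition address n x : n.-tuple bool := Tuple (size_itinerary n (val x)).

Definition word_point (w : seq bool) x : C :=
  exist _ (branches w (val x)) (mem_set (cantor_set_branches w (set_valP x))).

Lemma val_itv x : 0 <= val x <= 1.
Proof. exact/cantor_set_itv/set_valP. Qed.

Lemma address_word_cat w v n x : size w = n ->
  address n (word_point (w ++ v) x) = w :> seq bool.
Proof.
move=> <-; rewrite /= /branches foldr_cat.
apply: itinerary_branches; exact: cantor_set_branches (set_valP x).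
Qed.

Lemma address_word_point n (w : n.-tuple bool) x :
  address n (word_point w x) = w.
Proof.
apply: val_inj; have := @address_word_cat w [::] n x.
by rewrite cats0; apply; rewrite size_tuple.
Qed.

Lemma address_leq m n x y : (m <= n)%N -> address n x = address n y ->
  address m x = address m y.
Proof.
move=> mn /(congr1 val)/= e; apply: val_inj => /=; move: (val x) (val y) e.
elim: m n mn => // m IH [//|n] mn {}x {}y /= [e1 e2].
by rewrite -e1 in e2 *; rewrite (IH n _ _ _ e2).
Qed.

Lemma address_dist n x y :
  address n x = address n y -> `|val x - val y| <= 3^-1 ^+ n.
Proof. by case=> /itinerary_dist; apply; exact: set_valP. Qed.

Lemma near_address n x : \forall y \near x, address n y = address n x.
Proof.
apply/nbhs_ballP; exists (3^-1 ^+ n); first by rewrite /= exprn_gt0 ?invr_gt0.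
move=> y xy; apply/val_inj/dist_itinerary; [exact: set_valP..|].
by rewrite distrC; exact: xy.
Qed.

Lemma address_nbhs x (U : set C) : nbhs x U ->
  exists n, forall y, address n y = address n x -> U y.
Proof.
move=> /nbhs_ballP[e /= e0 eU].
have [k hk] := @exists_expr_lt R 3^-1 e ltac:(apply/andP; split; lra) e0.
exists k => y /esym/address_dist xy; apply: eU.
exact: le_lt_trans xy (hk _ (leqnn k)).
Qed.

Lemma compact_cantor : compact [set: C].
Proof. exact/compact_set_type/compact_cantor_set. Qed.

Lemma address_uniform (f : C -> 'rV[R]_N) e : continuous f -> 0 < e ->
  exists m, forall x y, address m x = address m y -> edist (f x) (f y) < e.
Proof.
move=> cf e0; have e20 : 0 < e / 2 by rewrite divr_gt0.
(* Compactness in its near-covering form: the depth [m] runs along [\oo], so a depth that works near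
   each point yields one for all points. *)
have := (compact_near_coveringP [set: C]).1 compact_cantor nat \oo
  (fun m x => forall y, address m x = address m y -> edist (f x) (f y) < e) _.
case=> [x _|m _ hm]; last by exists m => x; exact: (hm m (leqnn m)).
have : \forall y \near x, edist (f x) (f y) < e / 2.
  have cd : {for x, continuous (fun y => edist (f x) (f y))}.
    apply: (@continuous_comp _ _ _ (fun y => f x - f y) (@enorm R N)).
      apply: (@continuousB _ _ _ (cst (f x)) f); last exact: cf.
      exact: cst_continuous.
    exact: enorm_continuous.
  have := @cvgr_lt _ _ _ _ _ _ cd (e / 2).
  by rewrite /= {1}/Defs.edist subrr enorm0; apply.
move=> /address_nbhs[k hk].
near=> x' m => /= y xy.
have xx' : address k x' = address k x by near: x'; exact: near_address.
apply: le_lt_trans (edist_triangle (f x) _ _) _; rewrite [e]splitr ltrD//.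
  by rewrite edistC hk.
rewrite hk// -xx'; apply/esym/(address_leq _ xy).
by near: m; exact: nbhs_infty_ge.
Unshelve. all: by end_near.
Qed.

End GenericEmbeddings.

(** * Thin and spread embeddings: two sequences of open conditions *)

Section ThinSpread.
Context {R : realType} {N : nat}.
Local Notation C := (cantor_set R).
Implicit Types (x y : C) (f g : Emb R N).

(* [2 ^+ k] counts the addresses of length [k]. *)
Definition thin n : set (Emb R N) := [set f | exists k d,
  2 ^+ k * d < n.+1%:R^-1 /\
  forall x y, address k x = address k y -> edist (f x) (f y) <= d].

(** A single [d] serves all pieces and all forms, which makes the condition open; the factor
    [enorm u] makes it homogeneous in [u]. *)
Definition spread n : set (Emb R N) := [set f | exists2 d, 0 < d &
  forall (w : n.-tuple bool) u, exists x y,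
    [/\ address n x = w, address n y = w &
        d * enorm u <= `|dotv u (f x - f y)|]].

Lemma open_thin n : open (thin n).
Proof.
rewrite openE => f [k [d [kd fd]]]; apply/nbhs_ballP.
(* Moving [f] by [e] enlarges diameters by at most [2 * e]; this [e] puts the new total halfway
   between [2 ^+ k * d] and the permitted bound. *)
pose e := (n.+1%:R^-1 - 2 ^+ k * d) / (2 ^+ k * 4).
have p0 : 0 < 2 ^+ k :> R by rewrite exprn_gt0.
have e0 : 0 < e by rewrite divr_gt0 ?subr_gt0// mulr_gt0.
exists e => // g /= /ltW fg; exists k, (d + 2 * e); split.
  have -> : 2 ^+ k * (d + 2 * e) = (2 ^+ k * d + n.+1%:R^-1) / 2.
    by rewrite /e; field; rewrite ?pnatr_eq0 /= ?lt0r_neq0// ltr0n.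
  by rewrite ltr_pdivrMr// mulr_natr mulr2n ltrD2r.
move=> x y xy; have := edist_triangle (f x) (g x) (g y).
have := edist_triangle (f y) (f x) (g y).
have fgx := le_trans (edist_le_rho f g x) fg.
have fgy := le_trans (edist_le_rho f g y) fg.
by move: fgx (fd _ _ xy); rewrite (edistC (f x) (g x)); lra.
Qed.

Lemma open_spread n : open (spread n).
Proof.
rewrite openE => f [d d0 fd]; apply/nbhs_ballP.
(* Each of the two points costs the form at most [d / 4 * enorm u], so half of the lower bound
   survives. *)
exists (d / 4) => [|g /= /ltW fg]; first by rewrite /= divr_gt0.
exists (d / 2) => [|w u]; first by rewrite divr_gt0.
have [x [y [xw yw fxy]]] := fd w u; exists x, y; split=> //.
have near_u z : `|dotv u (f z - g z)| <= enorm u * (d / 4).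
  apply: le_trans (ler_norm_dotv _ _) _; rewrite ler_wpM2l ?enorm_ge0//.
  exact: le_trans (edist_le_rho f g z) fg.
have : dotv u (f x - f y) = dotv u (g x - g y) + dotv u (f x - g x) -
    dotv u (f y - g y).
  by rewrite !linearBr/=; ring.
move=> e; rewrite e in fxy.
have := ler_normB (dotv u (g x - g y) + dotv u (f x - g x))
  (dotv u (f y - g y)).
have := ler_normD (dotv u (g x - g y)) (dotv u (f x - g x)).
have := near_u x; have := near_u y.
lra.
Qed.

(** If all of [[p, q]] were attained, the pigeonhole principle with addresses as colours would bound
    [q - p] by [2 ^+ k * (enorm u * d)], hence by [enorm u / (n + 1)] for every [n]. *)
Lemma thin_no_interval f u p q : (forall n, thin n f) -> p < q ->
  exists2 s, p <= s <= q & forall x, dotv u (f x) != s.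
Proof.
move=> fthin pq; apply: contrapT => no_s.
have onto s : p <= s <= q -> exists x, dotv u (f x) = s.
  move=> spq; apply: contrapT => /forallNP fs; apply: no_s; exists s => // x.
  exact/eqP.
have small n : (q - p) * n.+1%:R <= enorm u.
  have [k [d [kd fd]]] := fthin n.
  have : q - p <= #|{: k.-tuple bool}|%:R * (enorm u * d).
    apply: (@interval_pigeonhole _ _ _ (address k)
      (fun x => dotv u (f x))) => //.
      move=> x y /fd xy; rewrite -linearBr/=.
      by apply: le_trans (ler_norm_dotv _ _) _; rewrite ler_wpM2l ?enorm_ge0.
    exact: ltW.
  rewrite card_tuple card_bool natrX mulrCA -ler_pdivlMr ?ltr0n//.
  by move=> /le_trans; apply; rewrite ler_wpM2l ?enorm_ge0// ltW.
have qp : 0 < q - p by rewrite subr_gt0.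
have := small (Num.truncn (enorm u / (q - p))).
rewrite -ler_pdivlMl// mulrC leNgt => /negP; apply.
by rewrite truncnS_gt.
Qed.

End ThinSpread.

(** * Density: rounding and perturbing along the moment curve *)

Section Approximation.
Context {R : realType} {N : nat}.
Local Notation C := (cantor_set R).
Implicit Types (x y : C) (f : Emb R N).

Definition cantor_zero : C := exist _ 0 (mem_set cantor_set0).

(** The left end of the piece with address [w]. *)
Definition base (w : seq bool) : C := word_point w cantor_zero.

Definition approximant f m (t : R) x : 'rV[R]_N :=
  f (base (address m x)) + t *: moment (val x).

Lemma approximant_continuous f m t : continuous (approximant f m t).
Proof.
move=> x; have FF := nbhs_filter x.
(* Near [x] the address is constant, so the approximant agrees there with the following map. *)
have : {for x, continuous
    (fun y => f (base (address m x)) + t *: @moment R N (val y))}.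
  apply: continuousD; first exact: cst_continuous.
  apply: (@continuous_comp _ _ _ (fun y : C => moment (val y))
    (fun v : 'rV[R]_N => t *: v)); last exact: scaler_continuous.
  apply: (@continuous_comp _ _ _ (set_val : C -> R)).
    exact: initial_continuous.
  exact: moment_continuous.
apply: cvg_trans; apply: near_eq_cvg.
by near=> y; rewrite /approximant (_ : address m y = address m x)//;
  near: y; exact: near_address.
Unshelve. all: by end_near.
Qed.

(** A Lipschitz constant of the moment curve on [[0, 1]], thus also a bound on its diameter
    there. *)
Let G : R := \sum_(k < N) k.+1%:R.

Lemma moment_edist_le x y : edist (@moment R N (val x)) (moment (val y)) <= G.
Proof.
apply: le_trans (edist_moment_le (val_itv x) (val_itv y)) _.
rewrite ler_piMr ?sumr_ge0//.
have /andP[? ?] := val_itv x; have /andP[? ?] := val_itv y.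
by rewrite ler_norml; apply/andP; split; lra.
Qed.

(** Finitely many values have a least positive distance. Equality of values, rather than of words,
    is what [approximant_inj] uses. *)
Lemma base_separation f m : exists2 e, 0 < e & forall w w' : m.-tuple bool,
  edist (f (base w)) (f (base w')) < e -> f (base w) = f (base w').
Proof.
have [|[w w']|e e0 he] :=
  @finite_uniform_pos R (m.-tuple bool * m.-tuple bool)%type
  (fun p e => edist (f (base p.1)) (f (base p.2)) < e ->
              f (base p.1) = f (base p.2)); last 1 first.
- by exists e => // w w'; exact: (he (w, w')).
- by move=> p d d' dd' h hd; apply: h; exact: lt_le_trans dd'.
have [ww'|ww'] := eqVneq (f (base w)) (f (base w')); first by exists 1.
exists (edist (f (base w)) (f (base w'))); last by rewrite ltxx.
rewrite lt_neqAle enorm_ge0 andbT eq_sym; apply: contra_neq ww' => /enorm_eq0.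
exact: subr0_eq.
Qed.

(** The moment terms differ by at most [t * G], less than the gap between distinct rounded values.
    So points with the same image have the same rounded value, and the injectivity of [moment]
    decides. *)
Lemma approximant_inj f m t e : (0 < N)%N -> 0 < t -> t * G < e ->
  (forall w w' : m.-tuple bool,
    edist (f (base w)) (f (base w')) < e -> f (base w) = f (base w')) ->
  injective (approximant f m t).
Proof.
move=> N0 t0 tG sep x y; rewrite /approximant => xy.
have fE : f (base (address m x)) = f (base (address m y)).
  apply: sep; apply: le_lt_trans tG.
  have -> : edist (f (base (address m x))) (f (base (address m y))) =
      t * edist (moment (val y)) (@moment R N (val x)).
    rewrite -[X in X * _]gtr0_norm// -enormZ; congr enorm.
    apply/eqP; rewrite scalerBr subr_eq addrAC eq_sym subr_eq eq_sym.
    by apply/eqP; rewrite [RHS]addrC.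
  by rewrite ler_pM2l// moment_edist_le.
apply/val_inj/(moment_inj N0)/(scalerI (lt0r_neq0 t0)).
by move: xy; rewrite fE => /addrI.
Qed.

Lemma approximant_edist f m t : 0 < t -> forall x y,
  address m x = address m y ->
  edist (approximant f m t x) (approximant f m t y) <=
  t * (G * `|val x - val y|).
Proof.
move=> t0 x y xy; rewrite /approximant xy.
have -> : edist (f (base (address m y)) + t *: moment (val x))
    (f (base (address m y)) + t *: moment (val y)) =
    t * edist (moment (val x)) (@moment R N (val y)).
  rewrite -[X in X * _](gtr0_norm t0) -enormZ; congr enorm.
  by rewrite opprD addrACA subrr add0r scalerBr.
by rewrite ler_pM2l// edist_moment_le// val_itv.
Qed.

(** At depth [k >= m] the rounded part is constant on each piece, so the [2^k] diameters add up to
    at most [t * G * (2/3)^k]. *)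
Lemma approximant_thin f m t (h : Emb R N) n :
  0 < t -> h =1 approximant f m t -> thin n h.
Proof.
move=> t0 hE.
have G0 : 0 <= G by exact: sumr_ge0.
(* The [+ 1] keeps the denominator positive even if [G = 0]. *)
have e0 : 0 < n.+1%:R^-1 / (t * G + 1).
  by rewrite divr_gt0 ?invr_gt0 ?ltr0n// ltr_wpDl// mulr_ge0// ltW.
have [k hk] := @exists_expr_lt R (2 / 3) _ ltac:(apply/andP; split; lra) e0.
exists (maxn k m), (t * (G * 3^-1 ^+ maxn k m)); split.
  have -> (K : nat) : 2 ^+ K * (t * (G * 3^-1 ^+ K)) = t * G * (2 / 3) ^+ K.
    by rewrite exprMn; ring.
  have := hk _ (leq_maxl k m).
  rewrite ltr_pdivlMr; last by rewrite ltr_wpDl// mulr_ge0// ltW.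
  apply: le_lt_trans; rewrite mulrC ler_wpM2l ?exprn_ge0 ?divr_ge0//.
  by rewrite lerDl.
move=> x y xy; rewrite !hE.
apply: le_trans (approximant_edist _ t0 (address_leq (leq_maxr k m) xy)) _.
by rewrite ler_pM2l// ler_wpM2l// address_dist.
Qed.

(** Inside a piece, choose [N + 1] distinct points with the same rounded value: differences of
    images are then [t] times differences on the moment curve, and [moment_spread] applies. *)
Lemma approximant_spread f m t (h : Emb R N) n :
  0 < t -> h =1 approximant f m t -> spread n h.
Proof.
move=> t0 hE; apply: finite_uniform_pos.
  move=> w d d' dd' hd u; have [x [y [xw yw hxy]]] := hd u.
  by exists x, y; split=> //; apply: le_trans hxy; rewrite ler_wpM2r ?enorm_ge0.
(* Padding [w] with [m] letters forces the chosen points into one piece of depth [m], however small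
   [n] is. *)
move=> w; pose v := nseq m false.
have p_cantor (i : nat) : cantor_set R (3^-1 ^+ i).
  elim: i => [|i IH]; first by rewrite expr0; exact: cantor_set1.
  by have := cantor_set_branch false IH; rewrite /branch exprSr.
pose z (i : 'I_N.+1) : C := exist _ (3^-1 ^+ i) (mem_set (p_cantor i)).
pose x i := word_point (w ++ v) (z i).
have x_inj : injective (fun i => val (x i)).
  move=> i j /=; rewrite branchesE [RHS]branchesE => /addrI.
  move=> /(mulfI (lt0r_neq0 (exprn_gt0 _ _))).
  rewrite invr_gt0 ltr0n => /(_ isT)/ieexprIn => /(_ _ _)/val_inj; apply.
    by rewrite invr_gt0.
  by rewrite invr_eq1 pnatr_eq1.
have [d d0 hd] := moment_spread x_inj.
exists (t * d) => [|u]; first exact: mulr_gt0.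
have xw i : address n (x i) = w.
  by apply: val_inj; apply: address_word_cat; exact: size_tuple.
have [i hi] := hd u; exists (x i), (x ord0); split=> //.
have xm : address m (x i) = address m (x ord0).
  have mn : (m <= n + m)%N by exact: leq_addl.
  have xwv j : address (n + m) (x j) = w ++ v :> seq bool.
    have := @address_word_cat R (w ++ v) [::] (n + m) (z j); rewrite cats0.
    by apply; rewrite size_cat size_tuple size_nseq.
  apply: (address_leq mn); apply: val_inj.
  exact: etrans (xwv i) (esym (xwv ord0)).
rewrite !hE /approximant xm opprD addrACA subrr add0r -scalerBr.
by rewrite linearZr_LR/= normrM gtr0_norm// -mulrA ler_pM2l.
Qed.

Lemma approximation f e : (0 < N)%N -> 0 < e -> exists h : Emb R N,
  [/\ rho f h < e, forall n, thin n h & forall n, spread n h].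
Proof.
move=> N0 e0; have e30 : 0 < e / 3 by rewrite divr_gt0.
have [m hm] := address_uniform (@continuous_emb R N f) e30.
have [s s0 sep] := base_separation f m.
have G0 : 0 < G.
  rewrite /G (bigD1 (Ordinal N0))//= ltr_wpDr// ?sumr_ge0//.
have q0 : 0 < Num.min s (e / 3) by rewrite lt_min s0.
(* Then [t * G] is half the minimum: below [s] for injectivity and below [e / 3] for closeness. *)
pose t := Num.min s (e / 3) / (2 * G).
have t0 : 0 < t by rewrite divr_gt0// mulr_gt0.
have tG : t * G < Num.min s (e / 3).
  have -> : t * G = Num.min s (e / 3) / 2.
    by rewrite /t; field; exact: lt0r_neq0.
  by rewrite ltr_pdivrMr// mulr_natr mulr2n ltrDr.
move: tG; rewrite lt_min => /andP[tGs tGe].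
have emb : embedding (approximant f m t).
  apply: injective_embedding.
  - exact: compact_cantor.
  - exact: norm_hausdorff.
  - exact: approximant_continuous.
  - exact: approximant_inj tGs sep.
exists (MkEmb emb); split=> [|n|n]; [|exact: approximant_thin t0 _|
  exact: approximant_spread t0 _].
(* A supremum inherits only a weak inequality, hence thirds of [e] instead of halves. *)
apply: (@le_lt_trans _ _ (e / 3 + e / 3)); last by lra.
apply: rho_le => x.
apply: le_trans (edist_triangle (f (base (address m x))) _ _) _.
apply: lerD.
  by apply/ltW/hm; rewrite address_word_point.
rewrite /= /approximant /Defs.edist opprD addNKr enormN enormZ gtr0_norm//.
apply: ltW; apply: le_lt_trans tGe; rewrite ler_pM2l//.
(* As [moment 0 = 0], the norm of [moment (val x)] is a distance on the curve. *)
have := moment_edist_le x cantor_zero; apply: le_trans.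
rewrite /Defs.edist le_eqVlt; apply/orP; left; apply/eqP; congr enorm.
by apply/rowP => k; rewrite !mxE /= expr0n subr0.
Qed.

End Approximation.

(** * Projections of thin and spread embeddings *)

Section CantorImages.
Context {R : realType}.
Local Notation C := (cantor_set R).

(** The preimage of an isolated point would be open and so contain a whole piece, on which [F] would
    be constant, against the splitting hypothesis. *)
Lemma cantor_like_image (T : topologicalType) (F : C -> T) :
  continuous F -> hausdorff_space T -> (forall y, exists x, F x = y) ->
  (forall n (w : n.-tuple bool), exists x y,
    [/\ address n x = w, address n y = w & F x != F y]) ->
  zero_dimensional T -> cantor_like T.
Proof.
move=> cF hT F_onto F_split zT; split=> //.
  apply/perfectTP => y oy; have [x xy] := F_onto y.
  have /address_nbhs[n hn] : nbhs x (F @^-1` [set y]).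
    by apply: (cF x [set y]); rewrite xy; exact: open_nbhs_nbhs.
  have [z [z' [zx z'x]]] := F_split n (address n x).
  by rewrite !hn// eqxx.
have <- : F @` [set: C] = [set: T].
  by apply/seteqP; split=> // y _; have [x xy] := F_onto y; exists x.
apply: continuous_compact compact_cantor.
exact: continuous_subspaceT.
Qed.

(** The identity splits every piece because its two ends differ, and the clopen sets of fixed
    address separate points. *)
Lemma cantor_like_cantor_set : cantor_like C.
Proof.
apply: (@cantor_like_image C idfun) => [x||y|n w|x y xy].
- exact: cvg_id.
- exact/hausdorff_set_type/Rhausdorff.
- by exists y.
- pose one : C := exist _ 1 (mem_set cantor_set1).
  exists (word_point w cantor_zero), (word_point w one).
  split; [exact: address_word_point..|].
  apply/negP => /eqP/(congr1 val)/=; rewrite branchesE [RHS]branchesE => /addrI.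
  rewrite mulr0 mulr1 => /esym/eqP.
  by rewrite expf_eq0 invr_eq0 pnatr_eq0 andbF.
- have [n xyn] : exists n, address n x <> address n y.
    apply: contrapT => /forallNP h; move/eqP: xy; apply; apply: val_inj.
    apply/eqP; rewrite -subr_eq0 -normr_eq0; apply/negPn/negP => xy0.
    have e0 : 0 < `|val x - val y| by rewrite lt_neqAle eq_sym xy0 normr_ge0.
    have [k hk] := @exists_expr_lt R 3^-1 _ ltac:(apply/andP; split; lra) e0.
    have /contrapT/address_dist := h k.
    by rewrite leNgt hk.
  have openA (P : n.-tuple bool -> Prop) : open [set z : C | P (address n z)].
    rewrite openE => z Pz; apply: filterS (near_address n z) => z' /= zz'.
    by rewrite zz'.
  exists [set z | address n z = address n x]; split=> //.
  + split; first exact: (openA (fun w => w = address n x)).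
    rewrite -openC.
    exact: (openA (fun w => w <> address n x)).
  + by move/esym.
Qed.

Lemma projection_is_cantor N (f : Emb R N) (L : {vspace 'rV[R]_N}) :
  (forall n, thin n f) -> (forall n, spread n f) -> L <> 0%VS ->
  is_cantor_space R (set_type (oproj L @` range f)).
Proof.
move=> fthin fspread /eqP L0.
pose K := oproj L @` range f.
have pK x : K (oproj L (f x)) by exists (f x) => //; exact: imageT.
pose F x : K := exist _ (oproj L (f x)) (mem_set (pK x)).
(* Forms given by vectors of [L] do not see the projection, so thinness and spreadness of [f] carry
   over to [K]. *)
have dotE u v : u \in L -> dotv u (oproj L v) = dotv u v.
  move=> uL; have [_ /(_ u uL)] := (oprojP L v (oproj L v)).1 erefl.
  by rewrite linearBl/= !(dotvC _ u) => /subr0_eq.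
have c_oproj : continuous (oproj L).
  by rewrite /oproj => v; exact: linear_rV_continuous.
have cF : continuous F.
  apply: continuous_comp_initial => x.
  apply: (@continuous_comp _ _ _ f (oproj L)); first exact: continuous_emb.
  exact: c_oproj.
apply: (homeomorphic_cantor_like cantor_zero (F cantor_zero)).
  exact: cantor_like_cantor_set.
apply: (cantor_like_image cF).
- exact/hausdorff_set_type/norm_hausdorff.
- move=> [y yK]; have /set_mem[_ [x _ <-] xy] := yK.
  by exists x; apply: val_inj.
- move=> n w; have [d d0 hd] := fspread n.
  have u0 : vpick L != 0 by rewrite vpick0.
  have [x [y [xw yw hxy]]] := hd w (vpick L).
  exists x, y; split=> //; apply/eqP => /(congr1 val)/= Fxy.
  have : 0 < d * enorm (vpick L).
    rewrite mulr_gt0// lt_neqAle enorm_ge0 andbT eq_sym.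
    by apply: contra_neq u0; exact: enorm_eq0.
  rewrite ltNge => /negP; apply; apply: le_trans hxy _.
  have pL := memv_pick L.
  by rewrite linearBr/= -(dotE _ (f x) pL) -(dotE _ (f y) pL) Fxy subrr normr0.
- move=> a b ab; have KL (z : K) : val z \in L.
    have /set_mem[v _ <-] := valP z; exact: memv_pi.
  (* The form along [b - a] separates [a] from [b], and thinness supplies a level [s] between them
     that it never takes. *)
  pose u := val b - val a; have uL : u \in L by rewrite rpredB.
  have ltab : dotv u (val a) < dotv u (val b).
    rewrite -subr_gt0 -linearBr/= dotv_gt0// subr_eq0 eq_sym.
    by apply: contra_neq ab; exact: val_inj.
  have [s /andP[as_ sb] hs] := thin_no_interval u fthin ltab.
  have hK (z : K) : dotv u (val z) != s.
    by have /set_mem[_ [x _ <-] <-] := valP z; rewrite dotE.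
  pose phi (z : K) := dotv u (val z).
  have cphi : continuous phi.
    move=> z.
    apply: (@continuous_comp _ _ _ (set_val : K -> 'rV[R]_N) (dotv u)).
      exact: initial_continuous.
    exact: dotv_continuous.
  exists (phi @^-1` [set r | r < s]); split.
  + split; first by apply: open_comp; [move=> z _; exact: cphi|exact: open_lt].
    (* As [s] is not attained, the open sublevel set is also closed. *)
    have -> : phi @^-1` [set r | r < s] = phi @^-1` [set r | r <= s].
      apply/seteqP; split=> z /=; first exact: ltW.
      by rewrite le_eqVlt (negPf (hK z)).
    by apply: closed_comp; [move=> z _; exact: cphi|exact: closed_le].
  + by rewrite /= lt_neqAle hK.
  + by apply/negP; rewrite -leNgt.
Qed.

End CantorImages.

Theorem corollary1p3 (R : realType) (N : nat) (hN : (1 <= N)%N) :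
  exists B : set (Emb R N),
    [/\ dense B, Gdelta B &
        forall f : Emb R N, B f ->
        forall L : {vspace 'rV[R]_N}, L <> 0%VS ->
          is_cantor_space R (set_type (oproj L @` range f))].
Proof.
exists (\bigcap_n (thin n `&` spread n)); split.
- move=> O [f Of] oO.
  have /nbhs_ballP[e /= e0 eO] : nbhs f O by exact: open_nbhs_nbhs.
  have [h [fh hthin hspread]] := approximation f hN e0.
  by exists h; split=> [|n _]; [exact: eO|split].
- exists (fun n => thin n `&` spread n) => // n.
  by apply: openI; [exact: open_thin|exact: open_spread].
- move=> f Bf L L0; apply: projection_is_cantor => // n.
    by have [] := Bf n I.
  by have [] := Bf n I.
Qed.
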